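(* For all integers $n\geq 0$, $$S(256n+171) \equiv S(64n+43) \pmod{16}.$$
   Context: For $|q|<1$ (or as formal power series in $q$), let $(a;q)_\infty:=\prod_{k\geq 0}(1-aq^k)$. The function $S(n)$ (the number of overpartitions of $n$ of Schur-type, in the sense of Broudy and Lovejoy) is defined by the generating function $$\sum_{n=0}^{\infty} S(n)q^n = \frac{1}{(q;q^6)_\infty(q^5;q^6)_\infty(q^6;q^6)_\infty}.$$ *)

(* Defs.v *)
From mathcomp Require Import all_boot all_order all_algebra.

Set Implicit Arguments.
Unset Strict Implicit.
Unset Printing Implicit Defensive.

Import Order.TTheory GRing.Theory Num.Theory.
Local Open Scope ring_scope.

(* f : fps R stands for the formal power series \sum_(n >= 0) f n * q ^ n. *)
Definition fps (R : Type) : Type := nat -> R.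

Section FormalPowerSeries.
Variable R : comUnitRingType.

Definition fps_one : fps R := fun n => (n == 0%N)%:R.

Definition fps_mul (f g : fps R) : fps R :=
  fun n => \sum_(i < n.+1) f i * g (n - i)%N.

(* The coefficients g n, ..., g 0 (in that order) of g = 1 / f, from
   f 0 * g n.+1 = - \sum_(i <= n) f i.+1 * g (n - i). *)
Fixpoint fps_inv_rev (f : fps R) (n : nat) : seq R :=
  if n is m.+1 then
    let s := fps_inv_rev f m in
    (- ((f 0%N)^-1 * \sum_(i < m.+1) f i.+1 * s`_i)) :: s
  else [:: (f 0%N)^-1].

Definition fps_inv (f : fps R) : fps R := fun n => head 0 (fps_inv_rev f n).

Definition qpoch_part (a m N : nat) : {poly R} :=
  \prod_(k < N) (1 - 'X^(a + m * k)).

(* (q^a; q^m)_oo for m > 0: the factors with k > n do not contribute to the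
   coefficient of q^n, see qpoch_stable. *)
Definition qpoch (a m : nat) : fps R := fun n => (qpoch_part a m n.+1)`_n.

Lemma qpoch_stable (a m n N : nat) :
  (0 < m)%N -> (n < N)%N -> (qpoch_part a m N)`_n = qpoch a m n.
Proof.
move=> m_gt0; elim: N => // N IHN; rewrite ltnS leq_eqVlt => /predU1P[->//|ltnN].
rewrite -IHN // /qpoch_part big_ord_recr /= mulrBr mulr1 coefB coefMXn.
suff -> : (n < a + m * N)%N by rewrite subr0.
by apply: leq_trans ltnN (leq_trans (leq_pmull _ m_gt0) (leq_addl _ _)).
Qed.

Lemma qpoch0 (a m : nat) : (0 < a)%N -> qpoch a m 0 = 1.
Proof.
move=> a_gt0; rewrite /qpoch /qpoch_part big_ord1 muln0 addn0 coefB coefXn.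
by rewrite coef1 /= ltn_eqF // subr0.
Qed.

Lemma fps_mulV (f : fps R) :
  f 0%N \is a GRing.unit -> fps_mul f (fps_inv f) =1 fps_one.
Proof.
move=> uf; have nthE n i : (i <= n)%N -> (fps_inv_rev f n)`_i = fps_inv f (n - i)%N.
  elim: n i => [|n IHn] [|i] //= lein; rewrite IHn ?subSS //.
case=> [|n]; first by rewrite /fps_mul big_ord1 /fps_inv /= mulrV.
rewrite /fps_mul big_ord_recl /= subn0 {1}/fps_inv /= mulrN mulVKr //.
rewrite -[RHS](addNr (\sum_(i < n.+1) f i.+1 * (fps_inv_rev f n)`_i)).
congr (_ + _); apply: eq_bigr => i _.
by rewrite nthE -1?ltnS // /bump /= add1n subSS.
Qed.

End FormalPowerSeries.

(* S(n), the coefficient of q^n in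
   1 / ((q; q^6)_oo (q^5; q^6)_oo (q^6; q^6)_oo). *)
Definition schurS (n : nat) : int :=
  fps_inv (fps_mul (fps_mul (qpoch int 1 6) (qpoch int 5 6)) (qpoch int 6 6)) n.

Lemma schurS_gf :
  fps_mul (fps_mul (fps_mul (qpoch int 1 6) (qpoch int 5 6)) (qpoch int 6 6)) schurS
  =1 fps_one int.
Proof. by apply: fps_mulV; rewrite /fps_mul !big_ord1 !qpoch0 // !mulr1 unitr1. Qed.

(* Main.v *)
From HB Require Import structures.
Require Import Defs.
From mathcomp Require Import all_boot all_order all_algebra.
From mathcomp Require Import boolp.
From mathcomp Require Import zify ring.

(**
Write f(a, b) for Ramanujan's theta function, the sum over k in Z of a^(k(k+1)/2) b^(k(k-1)/2),
and put A = f(q^2, q^4), G = f(q, q^5), C = f(q^3, q^3), H = f(q^6, q^18).  By the Jacobi triple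
product the generating function of S is 1 / (A(q^4) - q G(q^4)).  All theta identities needed are
instances of the 2-dissection of f(a, b) and of the product formula for f(a, b) f(c, d) with
ab = cd, both of which come from splitting Z, resp. Z^2, by parity, except
  C H (A^4 - q G^4) = A G (G^2 C^2 - 4 q A^2 H^2),
for which they only show that the difference D of the two sides satisfies D(q) = q v(q) D(q^2)
for some series v; hence D = 0.

Now t = q G H / (A C) is a Hauptmodul for Gamma_0(12), and r = q G^3 / C^3 = t (1 + 2 t).
As G = G(q^4) (y + q) and C = C(q^4) (1 + 2 q^3 h), where y = (A / G)(q^4) and h = (H / C)(q^4),
  r = q (y + q)^3 (1 + 2 q^3 h)^-3 (G / C)^3(q^4),
so the coefficients of q^(4n+2) in r^i / (q G) can be read off from binomial expansions.  Modulo
16, extracting them maps the span of r, r^2, r^3 over q G to itself; starting with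
\sum S(4n+3) q^(n+1) = (r + 2 r^2 + 12 r^3) / G, the successive numerators are 7 r + 8 r^3 and
then the fixed point 15 r + 8 r^2 + 8 r^3.
*)

Set Implicit Arguments.
Unset Strict Implicit.
Unset Printing Implicit Defensive.

Import GRing.Theory.
Local Open Scope ring_scope.

(** * The ring of formal power series *)

HB.instance Definition _ (R : Type) := gen_eqMixin (fps R).
HB.instance Definition _ (R : Type) := gen_choiceMixin (fps R).

Section FpsRing.
Variable R : comUnitRingType.
Implicit Types (f g h : fps R) (p : {poly R}).

Lemma fpsP f g : f =1 g -> f = g.
Proof. by move=> fg; apply/funext. Qed.

Definition fps_zero : fps R := fun=> 0.
Definition fps_opp f : fps R := fun n => - f n.
Definition fps_add f g : fps R := fun n => f n + g n.

Fact fps_addA : associative fps_add.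
Proof. by move=> f g h; apply/fpsP => n; apply: addrA. Qed.
Fact fps_addC : commutative fps_add.
Proof. by move=> f g; apply/fpsP => n; apply: addrC. Qed.
Fact fps_add0 : left_id fps_zero fps_add.
Proof. by move=> f; apply/fpsP => n; apply: add0r. Qed.
Fact fps_addN : left_inverse fps_zero fps_opp fps_add.
Proof. by move=> f; apply/fpsP => n; apply: addNr. Qed.

HB.instance Definition _ :=
  GRing.isZmodule.Build (fps R) fps_addA fps_addC fps_add0 fps_addN.

Definition eq_upto (n : nat) f g := forall i, (i <= n)%N -> f i = g i.

Lemma eq_upto_refl n f : eq_upto n f f. Proof. by []. Qed.
Arguments eq_upto_refl : clear implicits.

Lemma fps_mul_eq_upto n f f' g g' :
  eq_upto n f f' -> eq_upto n g g' -> eq_upto n (fps_mul f g) (fps_mul f' g').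
Proof.
move=> ff' gg' i le_in; apply: eq_bigr => j _.
by rewrite ff' ?gg' // (leq_trans _ le_in) ?leq_subr // -ltnS.
Qed.

Definition fps_of_poly p : fps R := fun n => p`_n.
Definition fps_trunc n f : {poly R} := \poly_(i < n.+1) f i.

Lemma fps_truncP n f : eq_upto n f (fps_of_poly (fps_trunc n f)).
Proof. by move=> i le_in; rewrite /fps_of_poly coef_poly ltnS le_in. Qed.
Arguments fps_truncP : clear implicits.

Lemma fps_mul_of_poly p p' :
  fps_mul (fps_of_poly p) (fps_of_poly p') = fps_of_poly (p * p').
Proof. by apply/fpsP => n; rewrite /fps_of_poly coefM. Qed.

Fact fps_mulA : associative (@fps_mul R).
Proof.
move=> f g h; apply/fpsP => n.
have [[tf tg] th] := (fps_truncP n f, fps_truncP n g, fps_truncP n h).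
rewrite (fps_mul_eq_upto tf (fps_mul_eq_upto tg th) (leqnn n)).
rewrite (fps_mul_eq_upto (fps_mul_eq_upto tf tg) th (leqnn n)).
by rewrite !fps_mul_of_poly mulrA.
Qed.

Fact fps_mulC : commutative (@fps_mul R).
Proof.
move=> f g; apply/fpsP => n; have [tf tg] := (fps_truncP n f, fps_truncP n g).
rewrite (fps_mul_eq_upto tf tg (leqnn n)) (fps_mul_eq_upto tg tf (leqnn n)).
by rewrite !fps_mul_of_poly mulrC.
Qed.

Fact fps_of_poly1 : fps_of_poly 1 = @fps_one R.
Proof. by apply/fpsP => n; rewrite /fps_of_poly coef1. Qed.

Fact fps_mul1 : left_id (@fps_one R) (@fps_mul R).
Proof.
move=> f; apply/fpsP => n; have tf := fps_truncP n f.
rewrite -fps_of_poly1 (fps_mul_eq_upto (eq_upto_refl n _) tf (leqnn n)).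
by rewrite fps_mul_of_poly mul1r tf.
Qed.

Fact fps_mulDl : left_distributive (@fps_mul R) fps_add.
Proof.
move=> f g h; apply/fpsP => n; rewrite /fps_add /fps_mul -big_split /=.
by apply: eq_bigr => i _; rewrite mulrDl.
Qed.

Fact fps_one_neq0 : @fps_one R != 0.
Proof. by apply/eqP => /(congr1 (@^~ 0%N))/eqP; rewrite oner_eq0. Qed.

HB.instance Definition _ := GRing.Zmodule_isComNzRing.Build (fps R)
  fps_mulA fps_mulC fps_mul1 fps_mulDl fps_one_neq0.

Lemma coef_fpsD f g n : (f + g) n = f n + g n. Proof. by []. Qed.
Lemma coef_fpsN f n : (- f) n = - f n. Proof. by []. Qed.
Lemma coef_fps1 n : (1 : fps R) n = (n == 0%N)%:R. Proof. by []. Qed.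
Lemma coef_fpsM f g n : (f * g) n = \sum_(i < n.+1) f i * g (n - i)%N.
Proof. by []. Qed.

Lemma coef_fps_sum (I : Type) (r : seq I) (P : pred I) (F : I -> fps R) n :
  (\sum_(i <- r | P i) F i) n = \sum_(i <- r | P i) F i n.
Proof. exact: (big_morph (fun f : fps R => f n)). Qed.

Fact fps_of_poly_is_zmod_morphism : zmod_morphism fps_of_poly.
Proof. by move=> p p'; apply/fpsP => n; apply: coefB. Qed.
Fact fps_of_poly_is_monoid_morphism : monoid_morphism fps_of_poly.
Proof. by split=> [|p p']; [apply: fps_of_poly1 | rewrite -fps_mul_of_poly]. Qed.

HB.instance Definition _ :=
  GRing.isZmodMorphism.Build {poly R} (fps R) fps_of_poly
    fps_of_poly_is_zmod_morphism.
HB.instance Definition _ :=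
  GRing.isMonoidMorphism.Build {poly R} (fps R) fps_of_poly
    fps_of_poly_is_monoid_morphism.

Lemma eq_uptoM n f f' g g' :
  eq_upto n f f' -> eq_upto n g g' -> eq_upto n (f * g) (f' * g').
Proof. exact: fps_mul_eq_upto. Qed.

Lemma eq_upto_sym n f g : eq_upto n f g -> eq_upto n g f.
Proof. by move=> fg i le_in; rewrite fg. Qed.

Lemma eq_upto_trans n g f h : eq_upto n f g -> eq_upto n g h -> eq_upto n f h.
Proof. by move=> fg gh i le_in; rewrite fg ?gh. Qed.

Definition fps_coef0 f := f 0%N.

Fact fps_coef0_is_zmod_morphism : zmod_morphism fps_coef0.
Proof. by []. Qed.
Fact fps_coef0_is_monoid_morphism : monoid_morphism fps_coef0.
Proof.
by split=> [|f g]; rewrite /fps_coef0 ?coef_fps1 // coef_fpsM big_ord1 subn0.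
Qed.
HB.instance Definition _ :=
  GRing.isZmodMorphism.Build (fps R) R fps_coef0 fps_coef0_is_zmod_morphism.
HB.instance Definition _ :=
  GRing.isMonoidMorphism.Build (fps R) R fps_coef0 fps_coef0_is_monoid_morphism.

Definition fps_unit : {pred fps R} := fun f => fps_coef0 f \is a GRing.unit.
Definition fps_invr f := if f \in fps_unit then fps_inv f else f.

Fact fps_mulVr : {in fps_unit, left_inverse 1 fps_invr *%R}.
Proof.
by move=> f uf; rewrite /fps_invr uf mulrC; apply/fpsP/fps_mulV.
Qed.
Fact fps_unitPl f g : g * f = 1 -> f \in fps_unit.
Proof.
move=> gf; apply/unitrPr; exists (fps_coef0 g).
by rewrite mulrC -rmorphM gf rmorph1.
Qed.
Fact fps_invr_out : {in [predC fps_unit], fps_invr =1 id}.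
Proof. by move=> f; rewrite inE /= /fps_invr => /negPf->. Qed.

HB.instance Definition _ := GRing.ComNzRing_hasMulInverse.Build (fps R)
  fps_mulVr fps_unitPl fps_invr_out.

Lemma unitfpsE f : (f \is a GRing.unit) = (f 0%N \is a GRing.unit).
Proof. by []. Qed.

Lemma eq_upto_mulI n u f g :
  u \is a GRing.unit -> eq_upto n (u * f) (u * g) -> eq_upto n f g.
Proof. by move=> uu /(eq_uptoM (eq_upto_refl n u^-1)); rewrite !mulKr. Qed.

Lemma coef_fps_signM k f n : ((-1) ^+ k * f) n = (-1) ^+ k * f n.
Proof. by rewrite -signr_odd -[in RHS]signr_odd; case: odd; rewrite ?mul1r ?mulN1r. Qed.

Definition fps_q : fps R := fps_of_poly 'X.

Lemma coef_fps_qXM k f n :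
  (fps_q ^+ k * f) n = if (n < k)%N then 0 else f (n - k)%N.
Proof.
have tf := fps_truncP n f; rewrite -rmorphXn /=.
rewrite (eq_uptoM (eq_upto_refl n _) tf (leqnn n)) -rmorphM /=.
by rewrite /fps_of_poly coefXnM; case: ltnP => // le_kn; rewrite [RHS]tf ?leq_subr.
Qed.

Lemma coef_fps_qM f n : (fps_q * f) n = if n is m.+1 then f m else 0.
Proof. by rewrite -[fps_q]expr1 coef_fps_qXM; case: n => // n; rewrite subn1. Qed.

Lemma fps_qXI k : injective ( *%R (fps_q ^+ k)).
Proof.
move=> f g fg; apply/fpsP => n; have := congr1 (fun h : fps R => h (n + k)%N) fg.
by rewrite !coef_fps_qXM ltnNge leq_addl addnK.
Qed.

(* For k = 0, where f(q ^ k) makes no sense, this is the constant series f 0. *)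
Definition fps_dil (k : nat) f : fps R :=
  fun n => if (k %| n)%N then f (n %/ k)%N else 0.

Lemma fps_dil_of_poly k p :
  (0 < k)%N -> fps_dil k (fps_of_poly p) = fps_of_poly (p \Po 'X^k).
Proof.
by move=> k_gt0; apply/fpsP => n; rewrite /fps_of_poly coef_comp_poly_Xn.
Qed.

Lemma eq_upto_dil k n f g : eq_upto n f g -> eq_upto n (fps_dil k f) (fps_dil k g).
Proof.
move=> fg i le_in; rewrite /fps_dil; case: ifP => // _.
by rewrite fg // (leq_trans (leq_div _ _)).
Qed.

Fact fps_dil_is_zmod_morphism k : zmod_morphism (fps_dil k).
Proof.
move=> f g; apply/fpsP => n; rewrite coef_fpsD coef_fpsN /fps_dil.
by case: ifP; rewrite ?subr0.
Qed.

Lemma fps_dil0 f : fps_dil 0 f = fps_of_poly (f 0%N)%:P.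
Proof.
by apply/fpsP => -[|n]; rewrite /fps_dil /fps_of_poly coefC // dvdn0 div0n.
Qed.

Fact fps_dil_is_monoid_morphism k : monoid_morphism (fps_dil k).
Proof.
case: k => [|k]; split=> [|f g]; rewrite ?fps_dil0 ?coef_fps1 //.
- by rewrite rmorph1.
- by rewrite -[(f * g) 0%N]/(fps_coef0 (f * g)) rmorphM polyCM rmorphM.
- by rewrite -[1 in LHS](rmorph1 fps_of_poly) fps_dil_of_poly // !rmorph1.
apply/fpsP => n; have [tf tg] := (fps_truncP n f, fps_truncP n g).
rewrite (eq_upto_dil k.+1 (eq_uptoM tf tg) (leqnn n)).
rewrite (eq_uptoM (eq_upto_dil k.+1 tf) (eq_upto_dil k.+1 tg) (leqnn n)).
by rewrite -rmorphM !fps_dil_of_poly // !rmorphM.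
Qed.

HB.instance Definition _ k :=
  GRing.isZmodMorphism.Build (fps R) (fps R) (fps_dil k)
    (fps_dil_is_zmod_morphism k).
HB.instance Definition _ k :=
  GRing.isMonoidMorphism.Build (fps R) (fps R) (fps_dil k)
    (fps_dil_is_monoid_morphism k).

Lemma fps_dil_q k : (0 < k)%N -> fps_dil k fps_q = fps_q ^+ k.
Proof.
by move=> k_gt0; rewrite fps_dil_of_poly // comp_polyX rmorphXn.
Qed.

(* The infinite descent f(q) = q v(q) f(q^k) forces f = 0. *)
Lemma fps_descent k v f : f = fps_q * (v * fps_dil k f) -> f = 0.
Proof.
move=> fE; apply/fpsP; elim/ltn_ind => n IHn; rewrite fE coef_fps_qM.
case: n IHn => // n IHn; rewrite coef_fpsM big1 // => i _.
rewrite /fps_dil; case: ifP => _; last by rewrite mulr0.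
by rewrite IHn ?mulr0 // ltnS (leq_trans (leq_div _ _)) ?leq_subr.
Qed.

End FpsRing.

Arguments eq_upto_refl {R}.
Arguments fps_coef0 {R}.
Arguments fps_of_poly {R}.
Local Notation q := (fps_q _).

(** * Series indexed by the values of an exponent function *)

Section QSum.
Variable R : comUnitRingType.
Implicit Types f g : fps R.

(* f is the series \sum_(i : I) w i * q ^ e i; s n lists the indices of exponent n. *)
Definition is_qsum (I : eqType) (w : I -> R) (e : I -> nat) f :=
  exists s : nat -> seq I, forall n,
    [/\ uniq (s n), forall i, (i \in s n) = (e i == n) & f n = \sum_(i <- s n) w i].

Lemma qsum_unique (I : eqType) (w : I -> R) (e : I -> nat) f g :
  is_qsum w e f -> is_qsum w e g -> f = g.
Proof.
move=> [s sP] [r rP]; apply/fpsP => n.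
have [us ms ->] := sP n; have [ur mr ->] := rP n.
by apply/perm_big/uniq_perm => // i; rewrite ms mr.
Qed.

Lemma eq_qsum (I : eqType) (w w' : I -> R) (e e' : I -> nat) f :
  w =1 w' -> e =1 e' -> is_qsum w e f -> is_qsum w' e' f.
Proof. by move=> /funext-> /funext->. Qed.

Lemma qsumN (I : eqType) (w : I -> R) (e : I -> nat) f :
  is_qsum w e f -> is_qsum (fun i => - w i) e (- f).
Proof.
move=> [s sP]; exists s => n; have [us ms fn] := sP n.
by split=> //; rewrite coef_fpsN fn sumrN.
Qed.

Lemma qsum_split (I J K : eqType) (w : I -> R) (e : I -> nat)
    (h : J -> I) (k : K -> I) f g :
    injective h -> injective k -> (forall j l, h j <> k l) ->
    (forall i, (exists j, i = h j) \/ (exists l, i = k l)) ->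
  is_qsum (w \o h) (e \o h) f -> is_qsum (w \o k) (e \o k) g -> is_qsum w e (f + g).
Proof.
move=> h_inj k_inj hk hk_surj [s sP] [r rP].
exists (fun n => map h (s n) ++ map k (r n)) => n.
have [us ms fn] := sP n; have [ur mr gn] := rP n; split.
- rewrite cat_uniq !map_inj_uniq // us ur andbT.
  by apply/hasPn => _ /mapP[l _ ->]; apply/mapP => -[j _ /esym]; apply: hk.
- move=> i; rewrite mem_cat; case: (hk_surj i) => -[j ->].
    by rewrite mem_map // ms orbC; case: mapP => // -[l _ /hk[]].
  by rewrite [k j \in map k _]mem_map // mr; case: mapP => // -[l _ /esym/hk].
- by rewrite coef_fpsD fn gn big_cat !big_map.
Qed.

(* The odd integers are written 1 - 2 k, and not 2 k + 1, because the odd part of a theta series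
   is then again a theta series without a further reflection of the index. *)
Lemma qsum_parity (w : int -> R) (e : int -> nat) f g :
    is_qsum (fun k => w (2 * k)) (fun k => e (2 * k)) f ->
    is_qsum (fun k => w (1 - 2 * k)) (fun k => e (1 - 2 * k)) g ->
  is_qsum w e (f + g).
Proof.
apply: qsum_split => [j k|j k|j k|i]; try lia.
have [k] : exists k, i = 2 * k \/ i = 1 - 2 * k.
  by case: (boolP ((i %% 2)%Z == 0)) => i2;
    [exists (i %/ 2)%Z | exists ((1 - i) %/ 2)%Z]; lia.
by case=> ->; [left | right]; exists k.
Qed.

(* The two maps parametrize the pairs (i, j) with i + j even and with i + j odd. *)
Lemma qsum_checkerboard (w : int * int -> R) (e : int * int -> nat) f g :
    is_qsum (fun p => w (p.1 + p.2, p.1 - p.2)) (fun p => e (p.1 + p.2, p.1 - p.2)) f ->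
    is_qsum (fun p => w (1 - p.1 - p.2, p.2 - p.1))
      (fun p => e (1 - p.1 - p.2, p.2 - p.1)) g ->
  is_qsum w e (f + g).
Proof.
apply: qsum_split => [[a b] [c d]|[a b] [c d]|[a b] [c d]|[i j]] /=.
- by move=> [? ?]; congr (_, _); lia.
- by move=> [? ?]; congr (_, _); lia.
- by move=> [? ?]; lia.
case: (boolP (((i + j) %% 2)%Z == 0)) => ij2; [left | right].
  by exists (((i + j) %/ 2)%Z, ((i - j) %/ 2)%Z); congr (_, _) => /=; lia.
by exists (((1 - i - j) %/ 2)%Z, ((1 - i + j) %/ 2)%Z); congr (_, _) => /=; lia.
Qed.

Lemma qsumM (I J : eqType) (w : I -> R) (w' : J -> R) (e : I -> nat) (e' : J -> nat) f g :
    is_qsum w e f -> is_qsum w' e' g ->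
  is_qsum (fun p : I * J => w p.1 * w' p.2) (fun p => e p.1 + e' p.2)%N (f * g).
Proof.
move=> [s sP] [r rP].
pose block n a := [seq (i, j) | i <- s a, j <- r (n - a)%N].
have blockP n a i j : ((i, j) \in block n a) = (e i == a) && (e' j == n - a)%N.
  have [[_ ms _] [_ mr _]] := (sP a, rP (n - a)%N).
  apply/allpairsP/andP => [[p [+ + [-> ->]]]|[ia jb]]; first by rewrite ms mr.
  by exists (i, j); rewrite /= ms mr.
exists (fun n => [seq p | a <- iota 0 n.+1, p <- block n a]) => n; split.
- apply: allpairs_uniq_dep => [|a _|]; first exact: iota_uniq.
    have [[us _ _] [ur _ _]] := (sP a, rP (n - a)%N).
    by apply: allpairs_uniq => // -[i j] [i' j'].
  move=> u v /allpairsPdep[a [[i j] [_ + ->]]] /allpairsPdep[b [[i' j'] [_ + ->]]] /=.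
  by rewrite !blockP => /andP[/eqP<- _] /andP[/eqP<- _] [-> ->].
- move=> [i j]; apply/allpairsPdep/eqP => [[a [p [+ + ijp]]]|eij].
    by rewrite -ijp blockP mem_iota /= => ? /andP[/eqP + /eqP]; lia.
  by exists (e i), (i, j); rewrite blockP mem_iota /= in eij *; split=> //; lia.
- rewrite coef_fpsM big_allpairs_dep -[in RHS](subn0 n.+1) -/(index_iota _ _).
  rewrite big_mkord; apply: eq_bigr => a _.
  have [[_ _ ->] [_ _ ->]] := (sP a, rP (n - a)%N).
  by rewrite big_allpairs mulr_suml; apply: eq_bigr => i _; rewrite mulr_sumr.
Qed.

Lemma qsum_dil (I : eqType) (w : I -> R) (e : I -> nat) k f :
  (0 < k)%N -> is_qsum w e f -> is_qsum w (fun i => k * e i)%N (fps_dil k f).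
Proof.
move=> k_gt0 [s sP].
exists (fun n => if (k %| n)%N then s (n %/ k)%N else [::]) => n; rewrite /fps_dil.
case: ifP => [/dvdnP[m ->]|k_ndvd].
  rewrite mulnK //; have [us ms fm] := sP m; split=> // i.
  by rewrite ms mulnC eqn_pmul2r.
split=> [|i|]; rewrite ?big_nil ?in_nil //.
by apply/esym/eqP => eki; rewrite -eki dvdn_mulr in k_ndvd.
Qed.

Lemma qsum_shift (I : eqType) (w : I -> R) (e : I -> nat) k f :
  is_qsum w e f -> is_qsum w (fun i => k + e i)%N (q ^+ k * f).
Proof.
move=> [s sP]; exists (fun n => if (n < k)%N then [::] else s (n - k)%N) => n.
rewrite coef_fps_qXM; case: ltnP => [lt_nk|le_kn].
  by split=> [|i|]; rewrite ?big_nil ?in_nil //; apply/esym/eqP; lia.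
by have [us ms fm] := sP (n - k)%N; split=> // i; rewrite ms; apply/eqP/eqP; lia.
Qed.

Definition zball (n : nat) : seq int := [seq i%:Z - n%:Z | i <- iota 0 (2 * n).+1].

Lemma mem_zball n k : (k \in zball n) = (`|k| <= n)%N.
Proof.
apply/mapP/idP => [[i]|le_kn]; first by rewrite mem_iota => ? ->; lia.
by exists (absz (k + n%:Z)); rewrite ?mem_iota; lia.
Qed.

Lemma uniq_zball n : uniq (zball n).
Proof. by rewrite map_inj_uniq ?iota_uniq // => i j; lia. Qed.

Definition zsum (w : int -> R) (e : int -> nat) : fps R :=
  fun n => \sum_(k <- zball n.+1 | e k == n) w k.

Lemma zsumP w e : (forall k, `|k| <= (e k).+1)%N -> is_qsum w e (zsum w e).
Proof.
move=> le_e; exists (fun n => [seq k <- zball n.+1 | e k == n]) => n.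
split=> [|k|]; first by rewrite filter_uniq ?uniq_zball.
  by rewrite mem_filter mem_zball; case: eqP => //= <-; rewrite le_e.
by rewrite big_filter.
Qed.

End QSum.

(** * Ramanujan's theta functions *)

Definition triangular (k : int) : nat := (`|(k * (k + 1))%R| %/ 2)%N.

Lemma triangularE k : 2 * (triangular k)%:Z = k * (k + 1).
Proof.
have k_ge0 : 0 <= k * (k + 1) by nia.
have [m kE] : exists m, k * (k + 1) = 2 * m.
  have [j] : exists j, k = 2 * j \/ k = 2 * j + 1 by exists (k %/ 2)%Z; lia.
  by case=> ->; [exists (j * (2 * j + 1)) | exists ((2 * j + 1) * (j + 1))]; ring.
by rewrite /triangular kE abszM mulKn //; lia.
Qed.

Definition theta_exp (a b : nat) (k : int) : nat :=
  (a * triangular k + b * triangular (- k))%N.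

Lemma theta_expE a b k :
  2 * (theta_exp a b k)%:Z = a%:Z * (k * (k + 1)) + b%:Z * (k * (k - 1)).
Proof.
have := triangularE k; have := triangularE (- k).
rewrite /theta_exp PoszD !PoszM => kN kP.
rewrite (_ : k * (k - 1) = - k * (- k + 1)); last by ring.
by rewrite -kP -kN; ring.
Qed.

Lemma leq_abs_theta_exp a b k : (0 < a + b)%N -> (`|k| <= (theta_exp a b k).+1)%N.
Proof.
have le_tri j : (`|j| <= (triangular j).+1)%N.
  have := triangularE j.
  by have [j_ge0 | [-> // | j_lt]] : 0 <= j \/ j = -1 \/ j <= -2; [lia | nia | nia].
rewrite addn_gt0 /theta_exp => /orP[a_gt0 | b_gt0].
  by rewrite (leq_trans (le_tri k)) // ltnS (leq_trans (leq_pmull _ a_gt0)) ?leq_addr.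
rewrite -abszN (leq_trans (le_tri (- k))) // ltnS.
by rewrite (leq_trans (leq_pmull _ b_gt0)) ?leq_addl.
Qed.

Lemma theta_exp_even a b k :
  theta_exp a b (2 * k) = theta_exp (3 * a + b) (a + 3 * b) k.
Proof.
by have := theta_expE a b (2 * k); have := theta_expE (3 * a + b) (a + 3 * b) k; lia.
Qed.

Lemma theta_exp_odd a b k : (a <= b)%N ->
  theta_exp a b (1 - 2 * k) = (a + theta_exp (b - a) (5 * a + 3 * b) k)%N.
Proof.
move=> /subnK; move: (b - a)%N => c <-.
have := theta_expE (c + a) (5 * a + 3 * (c + a)) k.
have := theta_expE a (c + a) (1 - 2 * k); have := theta_expE c (5 * a + 3 * (c + a)) k.
lia.
Qed.

Lemma theta_exp_addn_even a u v (x y : int) :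
  (theta_exp (a + (a + u)) (a + u + v + (a + v)) x
    + theta_exp (a + (a + v)) (a + u + v + (a + u)) y)%N
  = (theta_exp a (a + u + v) (x + y) + theta_exp (a + u) (a + v) (x - y))%N.
Proof.
have := theta_expE (a + (a + u)) (a + u + v + (a + v)) x.
have := theta_expE (a + (a + v)) (a + u + v + (a + u)) y.
have := theta_expE a (a + u + v) (x + y).
have := theta_expE (a + u) (a + v) (x - y).
lia.
Qed.

Lemma theta_exp_addn_odd a u v (x y : int) :
  (a + (theta_exp v (a + 2 * (a + u) + (a + v)) x
    + theta_exp u (a + (a + u) + 2 * (a + v)) y))%N
  = (theta_exp a (a + u + v) (1 - x - y) + theta_exp (a + u) (a + v) (y - x))%N.
Proof.
have := theta_expE v (a + 2 * (a + u) + (a + v)) x.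
have := theta_expE u (a + (a + u) + 2 * (a + v)) y.
have := theta_expE a (a + u + v) (1 - x - y).
have := theta_expE (a + u) (a + v) (y - x).
lia.
Qed.

Section Theta.
Variable R : comUnitRingType.

(* Ramanujan's theta function f(q ^ a, q ^ b). *)
Definition theta (a b : nat) : fps R := zsum (fun=> 1) (theta_exp a b).

Lemma thetaP a b : (0 < a + b)%N -> is_qsum (fun=> 1) (theta_exp a b) (theta a b).
Proof. by move=> ab_gt0; apply: zsumP => k; apply: leq_abs_theta_exp. Qed.

Lemma thetaMP a b c d : (0 < a + b)%N -> (0 < c + d)%N ->
  is_qsum (fun=> 1) (fun p => theta_exp a b p.1 + theta_exp c d p.2)%N
    (theta a b * theta c d).
Proof.
move=> ab_gt0 cd_gt0; apply: eq_qsum (qsumM (thetaP ab_gt0) (thetaP cd_gt0)) => // p.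
exact: mulr1.
Qed.

Lemma fps_dil_theta k a b : (0 < k)%N -> (0 < a + b)%N ->
  fps_dil k (theta a b) = theta (k * a) (k * b).
Proof.
move=> k_gt0 ab_gt0; apply: qsum_unique (qsum_dil k_gt0 (thetaP ab_gt0)) _.
apply: eq_qsum (thetaP _) => // [i|]; last by rewrite -mulnDr muln_gt0 k_gt0.
by rewrite /theta_exp mulnDr !mulnA.
Qed.

Lemma unitr_theta a b : (0 < a)%N -> (0 < b)%N -> theta a b \is a GRing.unit.
Proof.
case: a b => [|a] [|b] // _ _; rewrite unitfpsE /theta /zsum /theta_exp.
by rewrite big_mkcond !big_cons big_nil /= !muln0 !muln1 !addr0 !add0r unitr1.
Qed.

Lemma theta_split a b : (a <= b)%N -> (0 < b)%N ->
  theta a b = theta (3 * a + b) (a + 3 * b)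
    + q ^+ a * theta (b - a) (5 * a + 3 * b).
Proof.
move=> le_ab b_gt0; apply: (qsum_unique (thetaP _)); first by lia.
apply: qsum_parity.
  by apply: eq_qsum (thetaP _) => // [k|]; [rewrite theta_exp_even | lia].
apply: eq_qsum (qsum_shift a (thetaP _)) => // [k|]; last by lia.
by rewrite theta_exp_odd.
Qed.

Lemma signed_theta_split a b : (a <= b)%N -> (0 < b)%N ->
  zsum (fun k => (-1) ^+ `|k|) (theta_exp a b)
  = theta (3 * a + b) (a + 3 * b) - q ^+ a * theta (b - a) (5 * a + 3 * b).
Proof.
move=> le_ab b_gt0.
apply: qsum_unique (zsumP _ (fun k => leq_abs_theta_exp k _)) _; first by lia.
apply: qsum_parity.
  apply: eq_qsum (thetaP _) => [k|k|]; [|by rewrite theta_exp_even | by lia].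
  by rewrite -signr_odd (_ : odd _ = false) //; lia.
apply: eq_qsum (qsumN (qsum_shift a (thetaP _))) => [k|k|]; last by lia.
  by rewrite -signr_odd (_ : odd _ = true) //; lia.
by rewrite theta_exp_odd.
Qed.

Lemma theta0l b : (0 < b)%N -> theta 0 b = 2 * theta b (3 * b).
Proof.
by move=> b_gt0; rewrite theta_split // subn0 !muln0 !add0n expr0; ring.
Qed.

Lemma theta_mul a b c d :
    (a + b = c + d)%N -> (c <= b)%N -> (d <= b)%N -> (0 < b)%N ->
  theta a b * theta c d
  = theta (a + c) (b + d) * theta (a + d) (b + c)
    + q ^+ a * (theta (b - c) (a + 2 * c + d) * theta (b - d) (a + c + 2 * d)).
Proof.
move=> abcd le_cb le_db b_gt0; apply: (qsum_unique (thetaMP _ _)); [lia | lia |].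
have [u [v [bE -> ->]]] :
    exists u v, [/\ b = a + u + v, c = a + u & d = a + v]%N.
  by exists (b - d)%N, (b - c)%N; split; lia.
rewrite {}bE in abcd le_cb le_db b_gt0 *.
apply: qsum_checkerboard.
  apply: eq_qsum (thetaMP _ _) => // [[x y]||] /=; [|lia|lia].
  exact: theta_exp_addn_even.
have -> : (a + u + v - (a + u) = v)%N by lia.
have -> : (a + u + v - (a + v) = u)%N by lia.
apply: eq_qsum (qsum_shift a (thetaMP _ _)) => // [[x y]||] /=; [|lia|lia].
exact: theta_exp_addn_odd.
Qed.

Lemma theta_sqr a b : (a <= b)%N -> (0 < b)%N ->
  theta a b ^+ 2 = theta (2 * a) (2 * b) * theta (a + b) (a + b)
    + 2 * (q ^+ a * (theta (b - a) (3 * a + b) * theta (2 * (a + b)) (6 * (a + b)))).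
Proof.
move=> le_ab b_gt0; rewrite expr2 theta_mul // subnn theta0l; last by lia.
transitivity (theta (2 * a) (2 * b) * theta (a + b) (a + b) + q ^+ a *
    (theta (b - a) (3 * a + b) * (2 * theta (2 * (a + b)) (6 * (a + b))))); last by ring.
by congr (theta _ _ * theta _ _ + _ * (theta _ _ * (2 * theta _ _))); lia.
Qed.

Lemma theta_split_diag a : (0 < a)%N ->
  theta a a = theta (4 * a) (4 * a) + 2 * (q ^+ a * theta (8 * a) (24 * a)).
Proof.
move=> a_gt0; rewrite mulrCA {1}theta_split // subnn theta0l; last by lia.
by congr (theta _ _ + _ * (2 * theta _ _)); lia.
Qed.

Lemma theta_sqr_triple a : (0 < a)%N ->
  theta a (3 * a) ^+ 2 = theta a a * theta (2 * a) (6 * a).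
Proof.
move=> a_gt0; rewrite theta_sqr 1?[theta a a]theta_split_diag; [|lia|lia|lia].
transitivity (theta (2 * a) (6 * a) * theta (4 * a) (4 * a)
  + 2 * (q ^+ a * (theta (2 * a) (6 * a) * theta (8 * a) (24 * a)))); last by ring.
by congr (theta _ _ * theta _ _ + 2 * (_ * (theta _ _ * theta _ _))); lia.
Qed.

Lemma theta_mul_triple a : (0 < a)%N ->
  theta a (2 * a) * theta (3 * a) (9 * a) = theta a (5 * a) * theta (2 * a) (4 * a).
Proof.
move=> a_gt0.
have -> : theta a (2 * a) = theta (5 * a) (7 * a) + q ^+ a * theta a (11 * a).
  by rewrite theta_split; [congr (theta _ _ + _ * theta _ _) | |]; lia.
have -> : theta a (5 * a) * theta (2 * a) (4 * a)
    = theta (3 * a) (9 * a) * theta (5 * a) (7 * a)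
      + q ^+ a * (theta (3 * a) (9 * a) * theta a (11 * a)).
  by rewrite theta_mul;
    [congr (theta _ _ * theta _ _ + _ * (theta _ _ * theta _ _)) | | | |]; lia.
by ring.
Qed.

End Theta.

(** * The Jacobi triple product *)

Section QBinomial.
Variables (K : comNzRingType) (p : K).

Fixpoint qbin (n k : nat) : K :=
  match n, k with
  | _, 0%N => 1
  | 0%N, _.+1 => 0
  | n'.+1, k'.+1 => qbin n' k' + p ^+ k * qbin n' k
  end.

Lemma qbin0 n : qbin n 0 = 1. Proof. by case: n. Qed.

Lemma qbinS n k : qbin n.+1 k.+1 = qbin n k + p ^+ k.+1 * qbin n k.+1.
Proof. by []. Qed.

Lemma qbin_small n k : (n < k)%N -> qbin n k = 0.
Proof.
elim: n k => [|n IHn] [|k] //= lt_nk; rewrite !IHn ?mulr0 ?addr0 //.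
exact: ltnW.
Qed.

Lemma qbinn n : qbin n n = 1.
Proof. by elim: n => //= n ->; rewrite qbin_small // mulr0 addr0. Qed.

Lemma qbinomial n (u v : K) :
  \prod_(i < n) (u + v * p ^+ i)
  = \sum_(k < n.+1) qbin n k * p ^+ 'C(k, 2) * v ^+ k * u ^+ (n - k).
Proof.
elim: n v => [|n IHn] v; first by rewrite big_ord0 big_ord1 /= !mulr1.
rewrite big_ord_recl mulr1.
under eq_bigr => i _ do rewrite exprS mulrA.
rewrite IHn mulrDl !mulr_sumr.
pose a k := qbin n k * p ^+ ('C(k, 2) + k) * v ^+ k * u ^+ (n.+1 - k).
pose b k := qbin n k * p ^+ ('C(k, 2) + k) * v ^+ k.+1 * u ^+ (n - k).
transitivity (\sum_(k < n.+1) a k + \sum_(k < n.+1) b k).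
  congr (_ + _); apply: eq_bigr => k _.
    by rewrite /a subSn -1?ltnS // exprMn exprD exprS; ring.
  by rewrite /b exprMn exprD exprS; ring.
have -> : \sum_(k < n.+1) a k = \sum_(k < n.+2) a k.
  by rewrite [RHS]big_ord_recr /= {3}/a qbin_small // !mul0r addr0.
rewrite big_ord_recl [RHS]big_ord_recl -addrA -big_split.
congr (_ + _); first by rewrite /a qbin0.
apply: eq_bigr => k _.
by rewrite lift0 /= /a /b subSS binS bin1 !exprD !exprS; ring.
Qed.

Definition qfact (n : nat) : K := \prod_(i < n) (1 - p ^+ i.+1).

Lemma qfactS n : qfact n.+1 = qfact n * (1 - p ^+ n.+1).
Proof. by rewrite /qfact big_ord_recr. Qed.

Lemma qbin_fact k l : qbin (k + l) k * qfact k * qfact l = qfact (k + l).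
Proof.
have qfact0 : qfact 0 = 1 by rewrite /qfact big_ord0.
have [n] := ubnP (k + l)%N; elim: n k l => // n IHn [|k] [|l] lt_n;
  rewrite ?addn0 ?qbin0 ?qbinn ?qfact0 ?mulr1 ?mul1r //.
have IHk := IHn k l.+1 ltac:(lia); have IHl := IHn k.+1 l ltac:(lia).
rewrite addnS in IHk; rewrite addSn in IHl.
rewrite addSn addnS qbinS [RHS]qfactS.
transitivity ((1 - p ^+ k.+1) * (qbin (k + l).+1 k * qfact k * qfact l.+1)
  + p ^+ k.+1 * (1 - p ^+ l.+1) * (qbin (k + l).+1 k.+1 * qfact k.+1 * qfact l)).
  by rewrite !qfactS; ring.
have -> : p ^+ (k + l).+2 = p ^+ k.+1 * p ^+ l.+1 by rewrite -exprD addSn addnS.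
by rewrite IHk IHl; ring.
Qed.

End QBinomial.

Section JacobiTripleProduct.
Variables (R : comUnitRingType) (a b : nat).
Notation m := (a + b)%N.
Notation p := ('X^m : {poly R}).

Lemma qfact_qpoch_part n : qfact p n = qpoch_part R m m n.
Proof. by apply: eq_bigr => i _; rewrite -exprM mulnS. Qed.

Lemma prod_lower_half n :
  \prod_(i < n) (p ^+ n + - 'X^a * p ^+ i)
  = (-1) ^+ n * 'X^(n * a + m * 'C(n, 2)) * qpoch_part R b m n.
Proof.
have -> : (n * a + m * 'C(n, 2) = \sum_(i < n) (a + m * i))%N.
  by rewrite big_split /= sum_nat_const card_ord -big_distrr -bin2_sum big_mkord.
have -> : (-1) ^+ n * 'X^(\sum_(i < n) (a + m * i)) = \prod_(i < n) - 'X^(a + m * i) :> {poly R}.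
  by rewrite prodrN card_ord prodrXr.
have -> : qpoch_part R b m n = \prod_(i < n) (1 - 'X^(b + m * (n - i.+1))).
  by rewrite /qpoch_part (reindex_inj rev_ord_inj).
rewrite -big_split /=; apply: eq_bigr => i _.
have -> : p ^+ n = 'X^(a + m * i) * 'X^(b + m * (n - i.+1)).
  by rewrite -exprM -exprD; congr 'X^_; have := ltn_ord i; nia.
by rewrite -exprM exprD; ring.
Qed.

Lemma prod_upper_half n :
  \prod_(i < n) (p ^+ n + - 'X^a * p ^+ (n + i)) = p ^+ (n * n) * qpoch_part R a m n.
Proof.
have -> : p ^+ (n * n) = \prod_(i < n) p ^+ n by rewrite prodr_const card_ord exprM.
rewrite /qpoch_part -big_split /=; apply: eq_bigr => i _.
by rewrite [p ^+ (n + i)]exprD ['X^(a + m * i)]exprD ['X^(m * i)]exprM; ring.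
Qed.

Lemma theta_exp_bin n k : (k <= n + n)%N ->
  (m * 'C(k, 2) + k * a + m * (n * (n + n - k))
   = n * a + m * 'C(n, 2) + m * (n * n) + theta_exp a b (k%:Z - n%:Z))%N.
Proof.
have bin2D j : (2 * 'C(j, 2) + j = j * j)%N.
  by elim: j => // j IHj; rewrite binS bin1; lia.
move=> /subnK; move: (n + n - k)%N => l kl.
have := theta_expE a b (k%:Z - n%:Z); have := bin2D k; have := bin2D n.
nia.
Qed.

Lemma finite_triple_product n :
  qpoch_part R a m n * qpoch_part R b m n
  = \sum_(k < (n + n).+1)
      (-1) ^+ (n + k) * ('X^(theta_exp a b (k%:Z - n%:Z)) * qbin p (n + n) k).
Proof.
pose E := (n * a + m * 'C(n, 2) + m * (n * n))%N.
apply: (monic_lreg (monicXn R E)); rewrite /= /E.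
transitivity ((-1) ^+ n * \prod_(i < n + n) (p ^+ n + - 'X^a * p ^+ i)).
  rewrite big_split_ord /= prod_lower_half prod_upper_half exprD exprM.
  by rewrite -!mulrA signrMK; ring.
rewrite qbinomial !mulr_sumr; apply: eq_bigr => k _.
transitivity ((-1) ^+ (n + k) * 'X^(m * 'C(k, 2) + k * a + m * (n * (n + n - k)))
    * qbin p (n + n) k).
  have -> : 'X^(m * 'C(k, 2) + k * a + m * (n * (n + n - k)))
      = p ^+ 'C(k, 2) * 'X^a ^+ k * p ^+ n ^+ (n + n - k).
    by rewrite -!exprM -!exprD [(k * a)%N]mulnC mulnA.
  rewrite [(- 'X^a) ^+ k]exprNn [(-1) ^+ (n + k)]exprD.
  by move: ('X^a ^+ k) (p ^+ 'C(k, 2)) (p ^+ n ^+ _) => u v w; ring.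
by rewrite theta_exp_bin -1?ltnS // ['X^(_ + theta_exp _ _ _)]exprD; ring.
Qed.

Hypothesis m_gt0 : (0 < m)%N.
Notation qpochm := (qpoch R m m : fps R).

Lemma eq_upto_qpoch_part c N n : (N < n)%N ->
  eq_upto N (qpoch R c m) (fps_of_poly (qpoch_part R c m n)).
Proof.
by move=> lt_Nn i le_iN; rewrite /fps_of_poly qpoch_stable // (leq_ltn_trans le_iN).
Qed.

Lemma eq_upto_qfact N n : (N <= n)%N -> eq_upto N (fps_of_poly (qfact p n)) qpochm.
Proof.
move=> le_Nn i le_iN; rewrite -(@qpoch_stable _ m m i n.+1) //; last by lia.
rewrite /fps_of_poly qfact_qpoch_part [in RHS]/qpoch_part big_ord_recr /=.
by rewrite mulrBr mulr1 coefB coefMXn (_ : (i < _)%N = true) ?subr0 //; nia.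
Qed.

Lemma eq_upto_qbin_qpoch N k l : (N <= k)%N -> (N <= l)%N ->
  eq_upto N (fps_of_poly (qbin p (k + l) k) * qpochm) 1.
Proof.
move=> le_Nk le_Nl; have qpochm_unit : qpochm \is a GRing.unit.
  by rewrite unitfpsE qpoch0 ?unitr1.
apply: (eq_upto_mulI qpochm_unit); rewrite mulr1.
apply: (@eq_upto_trans _ _ (fps_of_poly (qfact p (k + l)))); last first.
  by apply: eq_upto_qfact; apply: leq_trans le_Nk (leq_addr _ _).
rewrite -qbin_fact !rmorphM /= mulrC.
have qfactE n : (N <= n)%N -> eq_upto N qpochm (fps_of_poly (qfact p n)).
  by move=> le_Nn; apply/eq_upto_sym/eq_upto_qfact.
exact: eq_uptoM (eq_uptoM (eq_upto_refl N _) (qfactE k le_Nk)) (qfactE l le_Nl).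
Qed.

Theorem jacobi_triple_product :
  qpoch R a m * qpoch R b m * qpochm = zsum (fun k => (-1) ^+ `|k|) (theta_exp a b).
Proof.
apply/fpsP => N; pose n := N.+1.
have partE c := eq_upto_qpoch_part c (ltnSn N).
rewrite (eq_uptoM (eq_uptoM (partE a) (partE b)) (eq_upto_refl N _) (leqnn N)).
rewrite -rmorphM finite_triple_product rmorph_sum mulr_suml coef_fps_sum.
rewrite /zsum /zball [RHS]big_mkcond big_map mul2n -addnn -[in RHS](subn0 (n + n).+1).
rewrite -/(index_iota _ _) big_mkord; apply: eq_bigr => k _.
move: (ltn_ord k); move: (nat_of_ord k) => {}k lt_k.
have [l nE] : exists l, (n + n = k + l)%N by exists (n + n - k)%N; lia.
have := @leq_abs_theta_exp a b (k%:Z - n%:Z) m_gt0.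
set e := theta_exp _ _ _ => le_e.
have sgnE : (-1) ^+ (n + k) = (-1) ^+ `|k%:Z - n%:Z| :> R.
  by rewrite -signr_odd -[RHS]signr_odd; congr (_ ^+ nat_of_bool _); lia.
rewrite nE !rmorphM rmorph_sign rmorphXn -!mulrA coef_fps_signM coef_fps_qXM sgnE /=.
case: ltnP => [lt_Ne | le_eN]; first by rewrite mulr0 gtn_eqF.
rewrite (@eq_upto_qbin_qpoch (N - e)) // ?coef_fps1; try lia.
by rewrite subn_eq0 eqn_leq le_eN; case: leqP; rewrite ?mulr1 ?mulr0.
Qed.

End JacobiTripleProduct.

(** * Arithmetic progressions of coefficients *)

Section Multisection.
Variables (R : comUnitRingType) (m : nat).
Implicit Types f g : fps R.

Definition multisect (r : nat) f : fps R := fun n => f (m * n + r)%N.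

Fact multisect_is_zmod_morphism r : zmod_morphism (multisect r).
Proof. by []. Qed.
HB.instance Definition _ r :=
  GRing.isZmodMorphism.Build (fps R) (fps R) (multisect r)
    (multisect_is_zmod_morphism r).

Hypothesis m_gt0 : (0 < m)%N.

Lemma multisect_qX_dil r i f : (r < m)%N -> (i < m)%N ->
  multisect r (q ^+ i * fps_dil m f) = if i == r then f else 0.
Proof.
move=> lt_rm lt_im; apply/fpsP => n; rewrite /multisect coef_fps_qXM /fps_dil.
case: (eqVneq i r) => [->|ne_ir]; first by rewrite ltnNge leq_addl addnK dvdn_mulr // mulKn.
case: ltnP => // le_i; case: ifP => // /dvdnP[k kE].
have : (m * n + r = i %[mod m])%N by rewrite -(subnK le_i) kE modnMDl.
by rewrite mulnC modnMDl !modn_small // => ri; rewrite ri eqxx in ne_ir.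
Qed.

Lemma fps_dissection f : f = \sum_(i < m) q ^+ i * fps_dil m (multisect i f).
Proof.
apply/fpsP => n; rewrite [in LHS](divn_eq n m) [in RHS](divn_eq n m) mulnC.
have lt_m : (n %% m < m)%N by rewrite ltn_mod.
rewrite -[LHS]/(multisect (n %% m) f (n %/ m)%N).
rewrite -[RHS]/(multisect (n %% m) (\sum_(i < m) _) (n %/ m)%N) raddf_sum /=.
under eq_bigr => i _ do rewrite multisect_qX_dil //.
by rewrite -big_mkcond (big_pred1 (Ordinal lt_m)).
Qed.

Lemma multisect_dilM r f g : (r < m)%N -> multisect r (fps_dil m f * g) = f * multisect r g.
Proof.
move=> lt_rm; rewrite {1}[g]fps_dissection mulr_sumr raddf_sum /=.
under eq_bigr => i _ do rewrite mulrCA -rmorphM multisect_qX_dil //.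
by rewrite -big_mkcond (big_pred1 (Ordinal lt_rm)).
Qed.

Lemma multisect0_qX k : multisect 0 (q ^+ k) = if (m %| k)%N then q ^+ (k %/ m) else 0.
Proof.
rewrite {1}(divn_eq k m) exprD mulnC exprM -fps_dil_q // -rmorphXn /=.
rewrite multisect_dilM // -[q ^+ (k %% m)]mulr1 -(rmorph1 (fps_dil m)).
by rewrite multisect_qX_dil ?ltn_mod // /dvdn; case: eqP; rewrite ?mulr1 ?mulr0.
Qed.

Lemma multisect0_qX_exprD c n f :
  multisect 0 (q ^+ c * (fps_dil m f + q) ^+ n)
  = \sum_(0 <= k < n.+1 | (m %| c + k)%N) f ^+ (n - k) * q ^+ ((c + k) %/ m) *+ 'C(n, k).
Proof.
rewrite exprDn mulr_sumr raddf_sum big_mkord [RHS]big_mkcond; apply: eq_bigr => k _ /=.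
rewrite mulrnAr raddfMn mulrCA -exprD -rmorphXn /= multisect_dilM // multisect0_qX.
by case: ifP; rewrite ?mulr0 ?mul0rn.
Qed.

End Multisection.

(** * The Hauptmodul of level 12 *)

Section Hauptmodul.
Variable R : comUnitRingType.

Notation dil := (@fps_dil R).
Notation G := (theta R 1 5).
Notation A := (theta R 2 4).
Notation C := (theta R 3 3).
Notation H := (theta R 6 18).

Let G_unit : G \is a GRing.unit. Proof. exact: unitr_theta. Qed.
Let A_unit : A \is a GRing.unit. Proof. exact: unitr_theta. Qed.
Let C_unit : C \is a GRing.unit. Proof. exact: unitr_theta. Qed.

Lemma weight3_relation :
  C * H * (A ^+ 4 - q * G ^+ 4) = A * G * (G ^+ 2 * C ^+ 2 - 4 * q * A ^+ 2 * H ^+ 2).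
Proof.
pose D := C * H * (A ^+ 4 - q * G ^+ 4)
  - A * G * (G ^+ 2 * C ^+ 2 - 4 * q * A ^+ 2 * H ^+ 2).
pose v := - 2 * (dil 2 A ^+ 2 - q * dil 2 G ^+ 2).
have GC : G * C = dil 2 A ^+ 2 + q * dil 2 G ^+ 2.
  by rewrite theta_mul // !fps_dil_theta // !expr2.
have AH : A * H = dil 2 G * dil 2 A.
  by rewrite (@theta_mul_triple R 2) // !fps_dil_theta.
have A2 : A ^+ 2 = dil 2 A * dil 2 C + 2 * (q ^+ 2 * (dil 2 G * dil 2 H)).
  by rewrite theta_sqr // !fps_dil_theta.
have G2 : G ^+ 2 = dil 2 G * dil 2 C + 2 * (q * (dil 2 A * dil 2 H)).
  by rewrite theta_sqr // !fps_dil_theta.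
have AGD : A * G * D = q * (v * dil 2 D).
  transitivity (G * C * (A * H) * ((A ^+ 2) ^+ 2 - q * (G ^+ 2) ^+ 2)
    - A ^+ 2 * G ^+ 2 * ((G * C) ^+ 2 - 4 * q * (A * H) ^+ 2)); first by rewrite /D; ring.
  rewrite GC AH A2 G2 /D !(rmorphB, rmorphM, rmorphXn, rmorph_nat) /= fps_dil_q //.
  by rewrite /v; ring.
have AG_unit : A * G \is a GRing.unit by rewrite unitrM A_unit G_unit.
apply: subr0_eq; apply: (@fps_descent _ 2 (v / (A * G))).
apply: (mulrI AG_unit); rewrite -/D AGD [RHS]mulrCA; congr (_ * _).
by rewrite mulrA [A * G * (v / _)]mulrC divrK.
Qed.

Definition quotAG : fps R := A / G.
Definition quotGC : fps R := G / C.
Definition quotHC : fps R := H / C.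

Lemma quotAGK : quotAG * G = A. Proof. exact: divrK G_unit _. Qed.
Lemma quotGCK : quotGC * C = G. Proof. exact: divrK C_unit _. Qed.
Lemma quotHCK : quotHC * C = H. Proof. exact: divrK C_unit _. Qed.

Definition modfun : fps R := q * quotGC ^+ 3.
Definition hauptmod : fps R := (q * (G * H)) / (A * C).
Notation r := modfun.
Notation t := hauptmod.

Let AC_unit : A * C \is a GRing.unit.
Proof. by rewrite unitrM A_unit C_unit. Qed.

Lemma hauptmod_mulAC : t * (A * C) = q * (G * H).
Proof. exact: divrK AC_unit _. Qed.

Lemma modfunE : r * C ^+ 3 = q * G ^+ 3.
Proof. by rewrite -mulrA -exprMn quotGCK. Qed.

Lemma hauptmod_quadratic : t * (1 + 2 * t) = r.
Proof.
have pent_sqr : theta R 1 2 ^+ 2 = A * C + 2 * (q * (G * H)) by rewrite theta_sqr.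
have psi_sqr : theta R 3 9 ^+ 2 = C * H by rewrite (@theta_sqr_triple R 3).
have pent_psi : theta R 1 2 * theta R 3 9 = G * A by rewrite (@theta_mul_triple R 1).
apply: (@mulIr _ (A ^+ 2 * C ^+ 3)); first by rewrite unitrM !unitrX.
transitivity (C * (t * (A * C)) * (A * C + 2 * (t * (A * C)))); first by ring.
rewrite hauptmod_mulAC -pent_sqr.
transitivity (q * G * (theta R 1 2 ^+ 2 * (C * H))); first by ring.
by rewrite -psi_sqr -exprMn pent_psi [RHS]mulrCA modfunE; ring.
Qed.

Lemma hauptmod_quartic : t * (1 + 4 * t) * A ^+ 4 = q * (1 + t) * G ^+ 4.
Proof.
apply: (@mulIr _ (A * C ^+ 2)); first by rewrite unitrM unitrX ?A_unit.
transitivity (t * (A * C) * (A * C + 4 * (t * (A * C))) * A ^+ 3); first by ring.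
rewrite hauptmod_mulAC.
transitivity (q * G * (G ^+ 3 * C * (A * C + t * (A * C)))); last by ring.
rewrite hauptmod_mulAC.
apply: subr0_eq; transitivity (q * G * (C * H * (A ^+ 4 - q * G ^+ 4)
  - A * G * (G ^+ 2 * C ^+ 2 - 4 * q * A ^+ 2 * H ^+ 2))); first by ring.
by rewrite weight3_relation subrr mulr0.
Qed.

Lemma hauptmod_quotAG : t * quotAG = q * quotHC.
Proof.
apply: (@mulIr _ (G * C)); first by rewrite unitrM G_unit.
transitivity (t * (quotAG * G * C)); first by ring.
rewrite quotAGK hauptmod_mulAC.
transitivity (q * (G * (quotHC * C))); last by ring.
by rewrite quotHCK.
Qed.

Lemma hauptmod_quotAG4 : t * (1 + 4 * t) * quotAG ^+ 4 = q * (1 + t).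
Proof.
apply: (@mulIr _ (G ^+ 4)); first by rewrite unitrX.
by rewrite -[LHS]mulrA -exprMn quotAGK hauptmod_quartic.
Qed.

Lemma G_factor : G = dil 4 G * (dil 4 quotAG + q).
Proof.
rewrite mulrDr -rmorphM /= [G * quotAG]mulrC quotAGK !fps_dil_theta // [_ * q]mulrC.
exact: (@theta_split R 1 5).
Qed.

Lemma C_factor : C = dil 4 C * (1 + 2 * (q ^+ 3 * dil 4 quotHC)).
Proof.
transitivity (dil 4 C + 2 * (q ^+ 3 * dil 4 (quotHC * C))).
  by rewrite quotHCK !fps_dil_theta // (@theta_split_diag R 3).
by rewrite rmorphM; ring.
Qed.

Lemma modfun_factor :
  r * (1 + 2 * (q ^+ 3 * dil 4 quotHC)) ^+ 3
  = q * (dil 4 quotAG + q) ^+ 3 * dil 4 (quotGC ^+ 3).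
Proof.
have C4_unit : dil 4 C \is a GRing.unit by rewrite rmorph_unit.
apply: (@mulIr _ (dil 4 C ^+ 3)); first by rewrite unitrX.
rewrite -[LHS]mulrA -exprMn [_ * dil 4 C]mulrC -C_factor modfunE {1}G_factor.
by rewrite -quotGCK rmorphM rmorphXn; ring.
Qed.

Lemma multisect3_theta_inv (f : fps R) :
  f * (dil 4 A - q * dil 4 G) = 1 -> multisect 4 3 f * (A ^+ 4 - q * G ^+ 4) = G ^+ 3.
Proof.
move=> f_inv; rewrite mulrC -multisect_dilM //.
have -> : dil 4 (A ^+ 4 - q * G ^+ 4) * f = q ^+ 0 * dil 4 (A ^+ 3)
    + q ^+ 1 * dil 4 (A ^+ 2 * G) + q ^+ 2 * dil 4 (A * G ^+ 2) + q ^+ 3 * dil 4 (G ^+ 3).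
  have -> : dil 4 (A ^+ 4 - q * G ^+ 4) = dil 4 A ^+ 4 - q ^+ 4 * dil 4 G ^+ 4.
    by rewrite -[q ^+ 4]fps_dil_q //; ring.
  transitivity (f * (dil 4 A - q * dil 4 G) * (dil 4 A ^+ 3 + q * dil 4 A ^+ 2 * dil 4 G
    + q ^+ 2 * dil 4 A * dil 4 G ^+ 2 + q ^+ 3 * dil 4 G ^+ 3)); first by ring.
  by rewrite f_inv; ring.
by rewrite !raddfD /= !multisect_qX_dil //= !add0r.
Qed.

End Hauptmodul.

(** * Reduction modulo 16 *)

Section Mod16.
Variable R : comUnitRingType.
Hypothesis R16 : 16%:R = 0 :> R.

Notation dil := (@fps_dil R).
Notation U4 := (multisect 4 0).
Notation G := (theta R 1 5).
Notation A := (theta R 2 4).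
Notation r := (modfun R).
Notation t := (hauptmod R).
Notation y := (quotAG R).
Notation g := (quotGC R).
Notation h := (quotHC R).

Let G_unit : G \is a GRing.unit. Proof. exact: unitr_theta. Qed.

Lemma fps16 : 16%:R = 0 :> fps R.
Proof. by rewrite -(rmorph_nat fps_of_poly) -(rmorph_nat polyC) R16 !rmorph0. Qed.

(* In the proofs below, the explicit argument is the quotient by 16 of the difference. *)
Lemma eq_mod16 (k f f' : fps R) : f = f' + 16 * k -> f = f'.
Proof. by move=> ->; rewrite fps16 mul0r addr0. Qed.
Arguments eq_mod16 k {f f'}.

Lemma quotGC_quotAG_mod16 : g ^+ 3 * y ^+ 4 = 1 - r + 8 * r ^+ 2 + 8 * r ^+ 3.
Proof.
apply: (@fps_qXI _ 1); rewrite mulrA -/(modfun R).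
transitivity (t * (1 + 4 * t) * y ^+ 4 * (1 + 2 * t) * (1 - 4 * t)).
  by rewrite -hauptmod_quadratic; apply: (eq_mod16 (t ^+ 3 * (1 + 2 * t) * y ^+ 4)); ring.
rewrite hauptmod_quotAG4 -hauptmod_quadratic.
by apply: (eq_mod16 (- q * (t ^+ 2 + 3 * t ^+ 3 + 5 * t ^+ 4 + 6 * t ^+ 5 + 4 * t ^+ 6))); ring.
Qed.

Lemma mul8_quotHC : 8 * h = 8 * (g ^+ 3 * y).
Proof.
apply: (@fps_qXI _ 1); rewrite mulrCA -hauptmod_quotAG.
transitivity (8 * (r * y)); last by rewrite /modfun; ring.
by rewrite -hauptmod_quadratic; apply: (eq_mod16 (- t ^+ 2 * y)); ring.
Qed.

Lemma mul8_quotHC_sqr : 8 * h ^+ 2 = 8 * (g ^+ 3 * y) ^+ 2.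
Proof.
transitivity (8 * h * h); first by ring.
rewrite mul8_quotHC; transitivity (g ^+ 3 * y * (8 * h)); first by ring.
by rewrite mul8_quotHC; ring.
Qed.

Lemma modfun_dissection (u := q ^+ 3 * dil 4 h) :
  r = q * (dil 4 y + q) ^+ 3 * dil 4 (g ^+ 3) * (1 - 6 * u + 8 * u ^+ 2).
Proof.
rewrite -modfun_factor -/u.
by apply: (eq_mod16 (r * (u ^+ 2 + u ^+ 3 - 3 * u ^+ 4 - 4 * u ^+ 5))); ring.
Qed.

(* U4 twisted by the factor of automorphy G, see hecke_multisect. *)
Definition hecke (f : fps R) : fps R := U4 (q * dil 4 G / G * f).

Lemma hecke_multisect (f : fps R) : hecke (q * f * G) = q * multisect 4 2 f * G.
Proof.
rewrite /hecke.
have -> : q * dil 4 G / G * (q * f * G) = dil 4 G * (q ^+ 2 * f) * (G / G) by ring.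
rewrite divrr // mulr1 multisect_dilM // mulrC; congr (_ * _).
apply/fpsP => -[|n]; rewrite /multisect coef_fps_qXM coef_fps_qM //.
by rewrite ltnNge (_ : (1 < _)%N = true); [congr (f _) |]; lia.
Qed.

Lemma hecke_modfunX n (u := q ^+ 3 * dil 4 h) :
  hecke (r ^+ n.+1)
  = U4 (dil 4 (g ^+ 3) ^+ n.+1 * (q ^+ n.+2 * (dil 4 y + q) ^+ (3 * n).+2)
        * (1 - 6 * u + 8 * u ^+ 2) ^+ n.+1).
Proof.
congr (U4 _); apply: (mulIr G_unit).
rewrite mulrAC divrK // modfun_dissection -/u {2}G_factor.
move: (dil 4 y + q) (dil 4 (g ^+ 3)) (1 - 6 * u + 8 * u ^+ 2) => z s w.
rewrite !exprMn -!exprD.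
have -> : (n.+1 + (n.+1 + n.+1) = (3 * n).+3)%N by lia.
by rewrite !exprS; ring.
Qed.

Lemma hecke_modfun : hecke r = r + 8 * r ^+ 2 + 8 * r ^+ 3.
Proof.
rewrite -[r in LHS]expr1 hecke_modfunX; set z := dil 4 y + q.
have -> : dil 4 (g ^+ 3) ^+ 1 * (q ^+ 2 * z ^+ 2)
    * (1 - 6 * (q ^+ 3 * dil 4 h) + 8 * (q ^+ 3 * dil 4 h) ^+ 2) ^+ 1
  = dil 4 (g ^+ 3) * (q ^+ 2 * z ^+ 2) - dil 4 (6 * g ^+ 3 * h) * (q ^+ 5 * z ^+ 2)
    + dil 4 (8 * g ^+ 3 * h ^+ 2) * (q ^+ 8 * z ^+ 2).
  by ring.
rewrite raddfD raddfB /= !multisect_dilM //.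
have -> : U4 (q ^+ 2 * z ^+ 2) = q.
  by rewrite multisect0_qX_exprD // unlock /= addr0 mul1r.
have -> : U4 (q ^+ 5 * z ^+ 2) = 0 by rewrite multisect0_qX_exprD // unlock.
have -> : U4 (q ^+ 8 * z ^+ 2) = y ^+ 2 * q ^+ 2.
  by rewrite multisect0_qX_exprD // unlock /= addr0.
transitivity (r + 8 * r ^+ 2 * (g ^+ 3 * y ^+ 4)).
  transitivity (g ^+ 3 * q + 8 * h ^+ 2 * (g ^+ 3 * y ^+ 2 * q ^+ 2)); first by ring.
  by rewrite mul8_quotHC_sqr /modfun; ring.
rewrite quotGC_quotAG_mod16.
by apply: (eq_mod16 (- r ^+ 3 + 4 * r ^+ 4 + 4 * r ^+ 5)); ring.
Qed.

Lemma hecke_modfun_sqr : hecke (r ^+ 2) = 5 * r + 4 * r ^+ 2 + 8 * r ^+ 3.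
Proof.
rewrite hecke_modfunX; set z := dil 4 y + q; set u := q ^+ 3 * dil 4 h.
have -> : (1 - 6 * u + 8 * u ^+ 2) ^+ 2 = 1 + 4 * u + 4 * u ^+ 2.
  by apply: (eq_mod16 (- u + 3 * u ^+ 2 - 6 * u ^+ 3 + 4 * u ^+ 4)); ring.
have -> : dil 4 (g ^+ 3) ^+ 2 * (q ^+ 3 * z ^+ 5) * (1 + 4 * u + 4 * u ^+ 2)
  = dil 4 (g ^+ 6) * (q ^+ 3 * z ^+ 5) + dil 4 (4 * g ^+ 6 * h) * (q ^+ 6 * z ^+ 5)
    + dil 4 (4 * g ^+ 6 * h ^+ 2) * (q ^+ 9 * z ^+ 5).
  by rewrite /u; ring.
rewrite !raddfD /= !multisect_dilM //.
have -> : U4 (q ^+ 3 * z ^+ 5) = y ^+ 4 * q *+ 5 + q ^+ 2.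
  by rewrite multisect0_qX_exprD // unlock /= addr0 mul1r.
have -> : U4 (q ^+ 6 * z ^+ 5) = y ^+ 3 * q ^+ 2 *+ 10.
  by rewrite multisect0_qX_exprD // unlock /= addr0.
have -> : U4 (q ^+ 9 * z ^+ 5) = y ^+ 2 * q ^+ 3 *+ 10.
  by rewrite multisect0_qX_exprD // unlock /= addr0.
transitivity (5 * r * (g ^+ 3 * y ^+ 4) + r ^+ 2 + 40 * r ^+ 2 * (g ^+ 3 * y ^+ 4)
    + 40 * r ^+ 3 * (g ^+ 3 * y ^+ 4)).
  transitivity (5 * q * g ^+ 6 * y ^+ 4 + g ^+ 6 * q ^+ 2
    + 8 * h * (5 * g ^+ 6 * y ^+ 3 * q ^+ 2)
    + 8 * h ^+ 2 * (5 * g ^+ 6 * y ^+ 2 * q ^+ 3)); first by ring.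
  by rewrite mul8_quotHC mul8_quotHC_sqr /modfun; ring.
rewrite quotGC_quotAG_mod16.
by apply: (eq_mod16 (2 * r ^+ 2 + 2 * r ^+ 3 + 20 * r ^+ 4 + 40 * r ^+ 5 + 20 * r ^+ 6)); ring.
Qed.

Lemma hecke_modfun_cube : hecke (r ^+ 3) = r + 4 * r ^+ 2 + 12 * r ^+ 3.
Proof.
rewrite hecke_modfunX; set z := dil 4 y + q; set u := q ^+ 3 * dil 4 h.
have -> : (1 - 6 * u + 8 * u ^+ 2) ^+ 3 = 1 - 2 * u + 4 * u ^+ 2 + 8 * u ^+ 3.
  by apply: (eq_mod16 (- u + 8 * u ^+ 2 - 32 * u ^+ 3 + 66 * u ^+ 4
    - 72 * u ^+ 5 + 32 * u ^+ 6)); ring.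
have -> : dil 4 (g ^+ 3) ^+ 3 * (q ^+ 4 * z ^+ 8) * (1 - 2 * u + 4 * u ^+ 2 + 8 * u ^+ 3)
  = dil 4 (g ^+ 9) * (q ^+ 4 * z ^+ 8) - dil 4 (2 * g ^+ 9 * h) * (q ^+ 7 * z ^+ 8)
    + dil 4 (4 * g ^+ 9 * h ^+ 2) * (q ^+ 10 * z ^+ 8)
    + dil 4 (8 * g ^+ 9 * h ^+ 3) * (q ^+ 13 * z ^+ 8).
  by rewrite /u; ring.
rewrite !(raddfB, raddfD) /= !multisect_dilM //.
have -> : U4 (q ^+ 4 * z ^+ 8) = y ^+ 8 * q + (y ^+ 4 * q ^+ 2 *+ 70 + q ^+ 3).
  by rewrite multisect0_qX_exprD // unlock /= addr0 mul1r.
have -> : U4 (q ^+ 7 * z ^+ 8) = y ^+ 7 * q ^+ 2 *+ 8 + y ^+ 3 * q ^+ 3 *+ 56.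
  by rewrite multisect0_qX_exprD // unlock /= addr0.
have -> : U4 (q ^+ 10 * z ^+ 8) = y ^+ 6 * q ^+ 3 *+ 28 + y ^+ 2 * q ^+ 4 *+ 28.
  by rewrite multisect0_qX_exprD // unlock /= addr0.
have -> : U4 (q ^+ 13 * z ^+ 8) = y ^+ 5 * q ^+ 4 *+ 56 + y * q ^+ 5 *+ 8.
  by rewrite multisect0_qX_exprD // unlock /= addr0.
transitivity (r * (g ^+ 3 * y ^+ 4) ^+ 2 + 70 * r ^+ 2 * (g ^+ 3 * y ^+ 4) + r ^+ 3).
  by rewrite /modfun; apply: (eq_mod16 (g ^+ 9 * h * (- y ^+ 7 * q ^+ 2 - 7 * y ^+ 3 * q ^+ 3
    + 7 * h * (y ^+ 6 * q ^+ 3 + y ^+ 2 * q ^+ 4)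
    + 4 * h ^+ 2 * (7 * y ^+ 5 * q ^+ 4 + y * q ^+ 5)))); ring.
rewrite quotGC_quotAG_mod16.
by apply: (eq_mod16 (4 * r ^+ 2 - 4 * r ^+ 3 + 35 * r ^+ 4 + 38 * r ^+ 5
  + 8 * r ^+ 6 + 4 * r ^+ 7)); ring.
Qed.

Definition modfun_cubic (a b c : nat) : fps R := a%:R * r + b%:R * r ^+ 2 + c%:R * r ^+ 3.

Lemma hecke_modfun_cubic a b c :
  hecke (modfun_cubic a b c)
  = modfun_cubic (a + 5 * b + c) (8 * a + 4 * b + 4 * c) (8 * a + 8 * b + 12 * c).
Proof.
have heckeM n f : hecke (n%:R * f) = n%:R * hecke f.
  by rewrite /hecke mulrCA !mulr_natl raddfMn.
have heckeD f f' : hecke (f + f') = hecke f + hecke f'.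
  by rewrite /hecke mulrDr raddfD.
rewrite !heckeD !heckeM hecke_modfun hecke_modfun_sqr hecke_modfun_cube.
by rewrite /modfun_cubic; ring.
Qed.

Lemma eq_modfun_cubic a b c a' b' c' :
    a = a' %[mod 16] -> b = b' %[mod 16] -> c = c' %[mod 16] ->
  modfun_cubic a b c = modfun_cubic a' b' c'.
Proof.
have natr_mod n : n%:R = (n %% 16)%:R :> fps R.
  by rewrite [in LHS](divn_eq n 16) natrD natrM fps16 mulr0 add0r.
rewrite /modfun_cubic (natr_mod a) (natr_mod b) (natr_mod c) => -> -> ->.
by rewrite -!natr_mod.
Qed.

Variable f : fps R.
Hypothesis f_inv : f * (theta R 8 16 - q * theta R 4 20) = 1.

Lemma multisect3_modfun_cubic : q * multisect 4 3 f * G = modfun_cubic 1 2 12.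
Proof.
pose D := A ^+ 4 - q * G ^+ 4.
have D_unit : D \is a GRing.unit.
  rewrite unitfpsE /D coef_fpsD coef_fpsN coef_fps_qM subr0.
  by rewrite -unitfpsE unitrX ?unitr_theta.
have fD : multisect 4 3 f * D = G ^+ 3.
  by apply: multisect3_theta_inv; rewrite !fps_dil_theta.
have gyG : g ^+ 3 * y ^+ 4 * G ^+ 4 = g ^+ 3 * A ^+ 4 by rewrite -mulrA -exprMn quotAGK.
apply: (mulIr D_unit).
transitivity (q * G * (multisect 4 3 f * D)); first by ring.
rewrite fD.
transitivity ((1 + 2 * r + 12 * r ^+ 2) * (q * (g ^+ 3 * A ^+ 4) - r * q * G ^+ 4)); last first.
  by rewrite /modfun_cubic /modfun /D; ring.
rewrite -gyG quotGC_quotAG_mod16.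
by apply: (eq_mod16 (- q * G ^+ 4 * (r ^+ 2 + 7 * r ^+ 4 + 6 * r ^+ 5))); ring.
Qed.

Lemma multisect_periodic :
  multisect 4 2 (multisect 4 2 (multisect 4 2 (multisect 4 3 f)))
  = multisect 4 2 (multisect 4 2 (multisect 4 3 f)).
Proof.
have sect_step b c d e : q * b * G = modfun_cubic c d e ->
    q * multisect 4 2 b * G
    = modfun_cubic (c + 5 * d + e) (8 * c + 4 * d + 4 * e) (8 * c + 8 * d + 12 * e).
  by move=> bE; rewrite -hecke_multisect bE hecke_modfun_cubic.
have /sect_step := multisect3_modfun_cubic.
rewrite (@eq_modfun_cubic _ _ _ 7 0 8) // => /sect_step.
rewrite (@eq_modfun_cubic _ _ _ 15 8 8) // => fix1; have := sect_step _ _ _ _ fix1.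
rewrite (@eq_modfun_cubic _ _ _ 15 8 8) // -fix1.
by move/(mulIr G_unit)/(@fps_qXI _ 1).
Qed.

End Mod16.

(** * The congruence *)

Section Map.
Variables (R S : comUnitRingType) (phi : {rmorphism R -> S}).

Definition fps_map (f : fps R) : fps S := fun n => phi (f n).

Fact fps_map_is_zmod_morphism : zmod_morphism fps_map.
Proof. by move=> f f'; apply/fpsP => n; apply: rmorphB. Qed.
Fact fps_map_is_monoid_morphism : monoid_morphism fps_map.
Proof.
split=> [|f f']; apply/fpsP => n; first exact: rmorph_nat.
by rewrite /fps_map !coef_fpsM rmorph_sum; apply: eq_bigr => i _; apply: rmorphM.
Qed.
HB.instance Definition _ :=
  GRing.isZmodMorphism.Build (fps R) (fps S) fps_map fps_map_is_zmod_morphism.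
HB.instance Definition _ :=
  GRing.isMonoidMorphism.Build (fps R) (fps S) fps_map fps_map_is_monoid_morphism.

Lemma fps_map_q : fps_map q = q.
Proof. by apply/fpsP => n; rewrite /fps_map /fps_q /fps_of_poly !coefX rmorph_nat. Qed.

Lemma fps_map_theta a b : fps_map (theta R a b) = theta S a b.
Proof.
apply/fpsP => n; rewrite /fps_map rmorph_sum.
by apply: eq_bigr => k _; apply: rmorph1.
Qed.

End Map.

Lemma schurS_theta : (schurS : fps int) * (theta int 8 16 - q * theta int 4 20) = 1.
Proof.
have <- : qpoch int 1 6 * qpoch int 5 6 * qpoch int 6 6 = theta int 8 16 - q * theta int 4 20.
  by rewrite (@jacobi_triple_product int 1 5) // signed_theta_split.
by rewrite mulrC; apply/fpsP/schurS_gf.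
Qed.

Lemma eqz_mod_Zp (n : nat) (x y : int) :
  (1 < n)%N -> x%:~R = y%:~R :> 'Z_n -> (x = y %[mod n])%Z.
Proof.
move=> n_gt1 xy; apply/eqP; rewrite eqz_mod_dvd.
have : (x - y)%:~R = 0 :> 'Z_n by rewrite rmorphB /= xy subrr.
have dvdn_Zp k : k%:R = 0 :> 'Z_n -> (n %| k)%N.
  by move/(congr1 val); rewrite /= val_Zp_nat // => /eqP.
case: (x - y) => k; first by move/dvdn_Zp.
by rewrite NegzE mulrNz => /eqP; rewrite oppr_eq0 => /eqP/dvdn_Zp; rewrite dvdzE abszN.
Qed.

Theorem theorem4p2 (n : nat) :
  (schurS (256 * n + 171)%N = schurS (64 * n + 43)%N %[mod 16])%Z.
Proof.
apply: (@eqz_mod_Zp 16 _ _ isT).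
have Z16 : 16%:R = 0 :> 'Z_16 by apply: pchar_Zp.
pose f := fps_map (intr : {rmorphism int -> 'Z_16}) schurS.
have f_inv : f * (theta _ 8 16 - q * theta _ 4 20) = 1.
  rewrite -!(fps_map_theta (intr : {rmorphism int -> 'Z_16})) -(fps_map_q intr).
  by rewrite -rmorphM -rmorphB -rmorphM schurS_theta rmorph1.
have := congr1 (fun g : fps 'Z_16 => g n) (multisect_periodic Z16 f_inv).
rewrite /multisect /f /fps_map.
have -> : (4 * (4 * (4 * (4 * n + 2) + 2) + 2) + 3 = 256 * n + 171)%N by lia.
by have -> : (4 * (4 * (4 * n + 2) + 2) + 3 = 64 * n + 43)%N by lia.
Qed.
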